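(* Let $n\ge 2$, let $\mathbb{E}^d=\mathbb{L}_1\oplus\cdots\oplus\mathbb{L}_n$ be a decomposition of $\mathbb{E}^d$ into the direct vector sum of its linear subspaces $\mathbb{L}_i$, and let $K_i\subseteq\mathbb{L}_i$ be convex bodies (in $\mathbb{L}_i$) such that $\mathrm{coin}(K_i)=f_{m_i}(K_i)$ for $i=1,\dots,n$, and let $\Gamma=\max\{\gamma_{m_i}(K_i):1\le i\le n\}$. If some $n-1$ of the $K_i$'s are tightly covered, then $$\max\{\mathrm{coin}(K_i):1\le i\le n\}\le \mathrm{coin}(K_1\oplus\cdots\oplus K_n)=\inf_{0<\lambda\le\frac12}\frac{\prod_{i=1}^nN_\lambda(K_i)}{1-\lambda}\le\frac{\prod_{i=1}^nN_\Gamma(K_i)}{1-\Gamma}\le\frac{\prod_{i=1}^nm_i}{1-\Gamma}<\prod_{i=1}^n\mathrm{coin}(K_i),$$ where $K_1\oplus\cdots\oplus K_n$ stands for the direct sum of the convex bodies $K_1\subseteq\mathbb{L}_1,\dots,K_n\subseteq\mathbb{L}_n$. Moreover, the first two upper bounds on $\mathrm{coin}(K_1\oplus\cdots\oplus K_n)$, namely $\frac{\prod_{i}N_\Gamma(K_i)}{1-\Gamma}$ and $\frac{\prod_{i}m_i}{1-\Gamma}$, are tight (i.e., there are instances in which they are attained with equality).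
   Context: A convex body in a $k$-dimensional real vector space (identified with $\mathbb{E}^k$) is a compact convex subset with nonempty interior relative to that space. For a convex body $K$ and $m\in\mathbb{N}=\{1,2,\dots\}$, $\gamma_m(K)=\inf\{\lambda>0:K\subseteq\bigcup_{i=1}^m(\lambda K+t_i)\text{ for some translation vectors }t_i\}$; $f_m(K)=\frac{m}{1-\gamma_m(K)}$ if $0<\gamma_m(K)\le\frac12$ and $f_m(K)=+\infty$ if $\frac12<\gamma_m(K)\le1$. The covering index is $\mathrm{coin}(K)=\inf\{f_m(K):m\in\mathbb{N}\}$. For $0<\lambda\le1$, $N_\lambda(K)$ is the minimum number of translates of $\lambda K$ needed to cover $K$. (All these quantities for $K_i$ are taken in $\mathbb{L}_i$.) $K$ is tightly covered if for every $0<\lambda<1$, $K$ contains $N_\lambda(K)$ points no two of which belong to the same homothet $\lambda K+t$ of $K$ with homothety ratio $\lambda$. The direct sum is $K_1\oplus\cdots\oplus K_n=\{k_1+\cdots+k_n:k_i\in K_i\}$. *)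

(* Defs.v *)
From mathcomp Require Import all_boot all_order all_algebra.
From mathcomp Require Import all_classical all_reals all_analysis.
Import Order.TTheory GRing.Theory Num.Theory.
Import numFieldNormedType.Exports.

Set Implicit Arguments.
Unset Strict Implicit.
Unset Printing Implicit Defensive.

Local Open Scope classical_set_scope.
Local Open Scope ring_scope.

Section Covering.
Context {R : realType} {d : nat}.
Notation V := 'rV[R]_d.
Implicit Types (L : {vspace V}) (K : set V) (lambda : R) (m : nat).

(* Interior is taken relative to [L]; the max-norm topology of ['rV[R]_d] is the
   Euclidean one. *)
Definition convex_body L K : Prop :=
  [/\ K `<=` [set` L], convex_set K, compact K &
      exists2 x, K x & \forall y \near x, y \in L -> K y].

Definition homothet lambda K (t : V) : set V :=
  [set lambda *: x + t | x in K].

(* The bodies live in [L], hence so do the translation vectors. *)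
Definition coverable L lambda m K : Prop :=
  exists t : 'I_m -> V, (forall i, t i \in L) /\
    K `<=` \bigcup_i homothet lambda K (t i).

Definition gamma L m K : R :=
  inf [set lambda | 0 < lambda /\ coverable L lambda m K].

(* For a convex body of positive dimension [0 < gamma L m K <= 1] whenever
   [0 < m], so the default branch is the case [1/2 < gamma L m K <= 1]. *)
Definition f_ L m K : \bar R :=
  if 0 < gamma L m K <= 2^-1 then (m%:R / (1 - gamma L m K))%:E else +oo%E.

Definition coin L K : \bar R :=
  ereal_inf [set f_ L m K | m in [set m | (0 < m)%N]].

(* The least [m] such that [m] translates suffice; the default value [0] is only
   taken when no finite family suffices, which cannot happen for a convex body
   and [0 < lambda]. *)
Definition covering_number L lambda K : nat :=
  xget 0%N [set m | coverable L lambda m K /\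
                    forall k, coverable L lambda k K -> (m <= k)%N].

Definition tightly_covered L K : Prop :=
  forall lambda, 0 < lambda < 1 ->
  exists p : 'I_(covering_number L lambda K) -> V,
    [/\ injective p, forall i, K (p i) &
        forall i j, i != j ->
        ~ exists2 t, t \in L &
            homothet lambda K t (p i) /\ homothet lambda K t (p j)].

Definition direct_sum {n} (K : 'I_n -> set V) : set V :=
  [set \sum_i k i | k in [set k : 'I_n -> V | forall i, K i (k i)]].

Definition covering_ratio {n} (L : 'I_n -> {vspace V}) (K : 'I_n -> set V)
    lambda : R :=
  (\prod_(i < n) covering_number (L i) lambda (K i))%N%:R / (1 - lambda).

(* Each [gamma] is nonnegative, so starting from [0] does not affect the
   maximum. *)
Definition Gamma {n} (L : 'I_n -> {vspace V}) (K : 'I_n -> set V)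
    (m : 'I_n -> nat) : R :=
  \big[Num.max/0]_(i < n) gamma (L i) (m i) (K i).

(* [L i != 0] makes the dimensions positive: for a point, [gamma] vanishes and
   [f_] has no meaning. *)
Definition coin_sum_hyp {n} (L : 'I_n -> {vspace V}) (K : 'I_n -> set V)
    (m : 'I_n -> nat) : Prop :=
  [/\ (2 <= n)%N,
      [/\ directv (\sum_(i < n) L i)%VS, (\sum_(i < n) L i)%VS = fullv &
          forall i, L i != 0%VS],
      forall i, convex_body (L i) (K i),
      forall i, (0 < m i)%N /\ coin (L i) (K i) = f_ (L i) (m i) (K i) &
      exists2 A : {set 'I_n}, #|A| = n.-1 &
        forall i, i \in A -> tightly_covered (L i) (K i)].

End Covering.

(* Main.v *)
Require Import Defs.
From mathcomp Require Import all_boot all_order all_algebra.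
From mathcomp Require Import all_classical all_reals all_analysis.
From mathcomp Require Import finmap lra ring.
Import Order.TTheory GRing.Theory Num.Theory.
Import numFieldNormedType.Exports.

Set Implicit Arguments.
Unset Strict Implicit.
Unset Printing Implicit Defensive.

Local Open Scope classical_set_scope.
Local Open Scope ring_scope.

(** The covering index is an infimum over the number [m] of homothets, but it is
    more convenient to let the ratio vary: for a convex body [K] of positive
    dimension, [coin K] is the infimum of [N_lambda(K) / (1 - lambda)] over
    [0 < lambda <= 1/2] ([coin_covering_number]). This rests on two facts about
    [gamma_m(K)]. It is positive, because [m] small homothets cannot contain
    [m + 1] equidistant points of a segment of [K] ([gamma_gt0]), and the infimum
    defining it is attained, by compactness of the set of translation vectors
    ([coverable_gamma]). Hence [m] homothets of ratio [lambda] cover [K] if and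
    only if [gamma_m(K) <= lambda], if and only if [N_lambda(K) <= m].

    Everything then follows from the multiplicativity of [N_lambda] on direct
    sums ([covering_number_direct_sum]). The sums of homothets taken from
    coverings of the summands cover the sum, which bounds [N_lambda] from above.
    Conversely, when all summands but [K_i0] are tightly covered, each tuple of
    points witnessing their tightness determines a fibre of the sum, which is a
    translate of [K_i0]; a covering of the sum uses at least [N_lambda(K_i0)]
    homothets on every fibre and, by the choice of the points, never the same
    homothet on two of them ([direct_sum_covering_ge]).

    Since every factor of [prod_i N_lambda(K_i)] is at least [1], the index of
    each summand is a lower bound. The upper bounds come from [lambda = Gamma],
    which lies in [(0, 1/2]], and from [N_Gamma(K_i) <= m_i]. The strict
    inequality holds because the product of the [1 - gamma_(m_i)(K_i)] contains
    [1 - Gamma] and, as there are at least two summands, another factor less than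
    [1].

    The unit square, as a sum of two segments with [m_i = 2], attains both upper
    bounds: [N_lambda >= 1 / lambda] for a segment, and
    [1 / (lambda ^ 2 * (1 - lambda)) >= 8] on [(0, 1/2]], with equality at
    [lambda = 1/2 = Gamma], where both upper bounds are [8]. *)

(** * Homothets and coverings *)

Section Homothets.
Context {R : realType} {d : nat}.
Notation V := 'rV[R]_d.
Implicit Types (L : {vspace V}) (K : set V) (lambda mu : R) (m : nat) (t x y : V).

Lemma convex_setP K :
  convex_set K <->
  (forall x y a, 0 <= a <= 1 -> K x -> K y -> K (a *: x + (1 - a) *: y)).
Proof.
split=> [cK x y a /andP[a0 a1] Kx Ky|cK x y a /set_mem Kx /set_mem Ky].
  by apply/set_mem; apply: (cK x y (Itv01 a0 a1)); apply/mem_set.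
by apply/mem_set; apply: cK => //; rewrite ge0 le1.
Qed.

Lemma homothetE lambda K t y : lambda != 0 ->
  homothet lambda K t y <-> K (lambda^-1 *: (y - t)).
Proof.
move=> l0; split=> [[x Kx <-]|Ky]; first by rewrite addrK scalerK.
by exists (lambda^-1 *: (y - t)); rewrite // scalerKV// subrK.
Qed.

Lemma coverableP L lambda m K :
  coverable L lambda m K <->
  exists2 t : 'I_m -> V, (forall i, t i \in L) &
    forall y, K y -> exists i, homothet lambda K (t i) y.
Proof.
split=> [[t [tL cov]]|[t tL cov]]; exists t => //.
  by move=> y /cov[i _ ?]; exists i.
by split=> // y /cov[i ?]; exists i.
Qed.

Lemma coverable_card L lambda K (I : finType) (t : I -> V) :
  (forall i, t i \in L) -> (forall y, K y -> exists i, homothet lambda K (t i) y) ->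
  coverable L lambda #|I| K.
Proof.
move=> tL cov; apply/coverableP; exists (t \o enum_val) => [i|y /cov[i ity]].
  exact: tL.
by exists (enum_rank i); rewrite /= enum_rankK.
Qed.

Lemma coverable_leq L lambda m k K : (m <= k)%N ->
  coverable L lambda m K -> coverable L lambda k K.
Proof.
move=> mk /coverableP[t tL cov]; apply/coverableP.
(* The additional homothets are placed at [0]. *)
exists (fun i : 'I_k => oapp t 0 (insub (val i))) => [i|y /cov[i ity]].
  by case: insub => [j|] /=; [exact: tL|exact: mem0v].
by exists (widen_ord mk i); rewrite (valK i : insub (val (widen_ord mk i)) = _).
Qed.

Lemma coverable_gt0 L lambda m K : K !=set0 -> coverable L lambda m K -> (0 < m)%N.
Proof. by case: m => // -[y Ky] /coverableP[t _ /(_ y Ky)[[]]]. Qed.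

Lemma coverable1 L m K : (0 < m)%N -> coverable L 1 m K.
Proof.
case: m => // m _; apply/coverableP; exists (fun=> 0) => [i|y Ky]; first exact: mem0v.
by exists ord0; apply/homothetE => //; rewrite invr1 scale1r subr0.
Qed.

(** The translation vector is chosen such that both homotheties send [x] to the
    same point, towards which the smaller image is a contraction of the larger. *)
Lemma homothet_le K lambda mu x t : convex_set K -> K x -> 0 < lambda <= mu ->
  homothet lambda K t `<=` homothet mu K (t - (mu - lambda) *: x).
Proof.
move=> /convex_setP cK Kx /andP[l0 lm] _ [y Ky <-].
have m0 : 0 < mu by exact: lt_le_trans lm.
apply/homothetE; first by rewrite gt_eqF.
rewrite opprB addrA addrAC addrK scalerBl addrC.
have -> : mu^-1 *: (mu *: x - lambda *: x + lambda *: y) =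
    (lambda / mu) *: y + (1 - lambda / mu) *: x.
  rewrite scalerDr scalerBr !scalerA mulVf ?gt_eqF// addrC scalerBl.
  by rewrite ![mu^-1 * _]mulrC.
by apply: cK => //; rewrite ler_pdivrMr// mul1r lm divr_ge0// ltW.
Qed.

Lemma coverable_le L lambda mu m K : K `<=` [set` L] -> convex_set K ->
  K !=set0 -> 0 < lambda <= mu ->
  coverable L lambda m K -> coverable L mu m K.
Proof.
move=> KL cK [x Kx] lm /coverableP[t tL cov]; apply/coverableP.
exists (fun i => t i - (mu - lambda) *: x) => [i|y /cov[i ity]].
  by rewrite memvB// memvZ//; exact: (KL x).
by exists i; exact: homothet_le ity.
Qed.

(** Pigeonhole principle, applied to a choice of a homothet for each point. *)
Lemma separated_not_coverable L lambda m K (p : 'I_m.+1 -> V) :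
  (forall i, K (p i)) ->
  (forall i j t, i != j -> t \in L ->
     homothet lambda K t (p i) -> homothet lambda K t (p j) -> False) ->
  ~ coverable L lambda m K.
Proof.
move=> Kp sep /coverableP[t tL cov].
have /choice[f fP] i : exists j, homothet lambda K (t j) (p i) by exact: cov.
suff /leq_card : injective f by rewrite !card_ord ltnn.
move=> i j fij; apply/eqP/contraT => ij.
by case: (sep i j (t (f i)) ij (tL _) (fP i)); rewrite fij.
Qed.

End Homothets.

(** * Covering numbers of convex bodies *)

Section ConvexBodies.
Context {R : realType} {d : nat}.
Notation V := 'rV[R]_d.
Implicit Types (L : {vspace V}) (K : set V) (lambda mu : R) (m : nat) (t x y v : V).

Lemma compact_norm_le K : compact K -> exists2 M : R, 0 < M & forall x, K x -> `|x| <= M.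
Proof.
move=> /compact_bounded[M [Mreal KM]]; exists (`|M| + 1); first exact: ltr_wpDl.
by apply: KM; rewrite (le_lt_trans (ler_norm M))// ltrDl.
Qed.

(** Distinct points of the progression are at least [`|v| / m] apart, while two
    points of a homothet of ratio [lambda] are at most [lambda * D] apart. *)
Lemma equidistant_separated K (D : R) lambda m x v t (i j : 'I_m.+1) :
  (forall a b, K a -> K b -> `|a - b| <= D) -> 0 < lambda ->
  lambda * m%:R * D < `|v| -> i != j ->
  homothet lambda K t (x + (i%:R / m%:R) *: v) ->
  homothet lambda K t (x + (j%:R / m%:R) *: v) -> False.
Proof.
move=> KD l0 small ij [a Ka eqa] [b Kb eqb].
have m0 : 0 < m%:R :> R.
  by rewrite ltr0n; case: m i j ij {small eqa eqb} => // i j; rewrite !ord1.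
have : lambda *: (a - b) = ((i%:R - j%:R) / m%:R) *: v.
  transitivity (x + (i%:R / m%:R) *: v - (x + (j%:R / m%:R) *: v)).
    by rewrite -eqa -eqb opprD addrACA subrr addr0 scalerBr.
  by rewrite opprD addrACA subrr add0r -scalerBl mulrBl.
move=> /(congr1 Num.norm); rewrite !normrZ gtr0_norm// normfV.
rewrite (gtr0_norm m0) => eqn.
have ij1 : 1 <= `|i%:R - j%:R| :> R.
  rewrite -[i%:R]/(i%:Z%:~R) -[j%:R]/(j%:Z%:~R) -intrB -intr_norm -[1]/(1%:~R) ler_int.
  by rewrite -gtz0_ge1 normr_gt0 subr_eq0.
have : `|v| <= lambda * m%:R * D.
  apply: (@le_trans _ _ (`|i%:R - j%:R| * `|v|)); first by rewrite ler_peMl.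
  have <- : lambda * `|a - b| * m%:R = `|i%:R - j%:R| * `|v|.
    by rewrite eqn mulrAC divfK// lt0r_neq0.
  rewrite mulrAC.
  by apply: ler_wpM2l; [rewrite mulr_ge0 ?ltW|exact: KD].
by rewrite leNgt small.
Qed.

Lemma convex_body_contains_segment L K : convex_body L K -> L != 0%VS ->
  exists x v, [/\ v != 0, K x & K (x + v)].
Proof.
move=> [KL cK _ [x Kx nK]] L0; exists x.
have [w wL w0] : exists2 w, w \in L & w != 0.
  by exists (vpick L); [exact: memv_pick|rewrite vpick0].
have xL : x \in L by exact: KL.
move: nK => /nbhs_ballP[e /= e0 nK].
pose c := e / 2 / `|w|.
have c0 : 0 < c by rewrite !divr_gt0// normr_gt0.
exists (c *: w); split => //; first by rewrite scaler_eq0 negb_or w0 gt_eqF.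
apply: nK; last by rewrite memvD// memvZ.
rewrite -ball_normE /ball_/= opprD addrA subrr sub0r normrN normrZ gtr0_norm//.
by rewrite /c divfK ?normr_eq0// ltr_pdivrMr// mulr_natr mulr2n ltrDl.
Qed.

(** Let [x] be an interior point of [K]. Then [lambda *: K] contains a ball of [L]
    centred at [lambda *: x], and finitely many balls of its radius cover [K]. *)
Lemma convex_body_coverable L K lambda : convex_body L K -> 0 < lambda ->
  exists m, coverable L lambda m K.
Proof.
move=> [KL cK compK [x Kx /nbhs_ballP[e /= e0 nK]]] l0.
have le0 : 0 < lambda * e by exact: mulr_gt0.
move: compK; rewrite compact_cover.
move=> /(_ _ K (ball^~ (lambda * e)))[y _|y Ky|D DK cov]; first exact: ball_open.
  by exists y => //; exact: ballxx.
exists #|{: D}|; apply: (coverable_card (t := fun y : D => val y - lambda *: x)) => [y|z Kz].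
  by rewrite memvB ?memvZ//; [apply/KL/set_mem/DK/valP|exact: KL].
have [y /= yD yz] := cov z Kz; exists [` yD]%fset; apply/homothetE; first by rewrite gt_eqF.
rewrite /= opprB addrA -addrAC scalerDr scalerK ?gt_eqF//.
have zyL : z - y \in L by rewrite memvB//; [exact: KL|apply/KL/set_mem/DK].
apply: nK; last by rewrite memvD ?memvZ//; exact: KL.
move: yz; rewrite -ball_normE/= /ball_/= opprD addrCA subrr addr0 normrN.
by rewrite normrZ gtr0_norm ?invr_gt0// ltr_pdivrMl// distrC.
Qed.

Lemma covering_numberP L K lambda m : convex_body L K -> 0 < lambda ->
  coverable L lambda m K <-> (covering_number L lambda K <= m)%N.
Proof.
move=> bK l0; rewrite /covering_number; case: xgetP => [N _ [covN minN]|none].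
  by split=> [|Nm]; [exact: minN|exact: coverable_leq covN].
have ex : exists k, `[< coverable L lambda k K >].
  by have [k ?] := convex_body_coverable bK l0; exists k; exact/asboolP.
case: (ex_minnP ex) => k /asboolP covk mink; case: (none k); split=> // j covj.
exact/mink/asboolP.
Qed.

Lemma covering_number_gt0 L K lambda : convex_body L K -> 0 < lambda ->
  (0 < covering_number L lambda K)%N.
Proof.
move=> bK l0; apply: (@coverable_gt0 _ _ L lambda _ K).
  by case: bK => _ _ _ [x Kx _]; exists x.
exact/covering_numberP.
Qed.

Lemma gamma_le L K lambda m : 0 < lambda -> coverable L lambda m K ->
  gamma L m K <= lambda.
Proof. by move=> l0 cov; apply: ge_inf => //; exists 0 => mu [/ltW]. Qed.

Lemma coverable_gamma_lt L K lambda m : convex_body L K -> (0 < m)%N ->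
  gamma L m K < lambda -> coverable L lambda m K.
Proof.
move=> [KL cK _ [x Kx _]] m0 gl.
have hi : has_inf [set lambda | 0 < lambda /\ coverable L lambda m K].
  split; last by exists 0 => mu [/ltW].
  by exists 1; split => //; exact: coverable1.
have e0 : 0 < lambda - gamma L m K by rewrite subr_gt0.
have [mu [mu0 cov]] := inf_adherent e0 hi; rewrite addrC subrK => mul.
by apply: coverable_le cov; rewrite ?mu0 ?ltW//; exists x.
Qed.

(** A compact body has finite diameter, so that a very small ratio separates
    [m + 1] equidistant points of a segment of the body. *)
Lemma gamma_gt0 L K m : convex_body L K -> L != 0%VS -> (0 < m)%N ->
  0 < gamma L m K.
Proof.
move=> bK L0 m0; have [x [v [v0 Kx Kxv]]] := convex_body_contains_segment bK L0.
have [KL /convex_setP cK compK _] := bK.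
have [M M0 KM] := compact_norm_le compK.
have nv0 : 0 < `|v| by rewrite normr_gt0.
have mM0 : 0 < m%:R * (M + M) by rewrite mulr_gt0 ?ltr0n ?addr_gt0.
(* [M + M] bounds the diameter of [K]. *)
apply: (@lt_le_trans _ _ (`|v| / (m%:R * (M + M)))); first exact: divr_gt0.
apply: lb_le_inf; first by exists 1; split => //; exact: coverable1.
move=> lambda [l0 cov]; rewrite leNgt; apply/negP; rewrite ltr_pdivlMr// mulrA => small.
pose p (i : 'I_m.+1) := x + (i%:R / m%:R) *: v.
apply: (separated_not_coverable (p := p)) cov => [i|i j t ij _].
  rewrite /p.
  have -> : x + (i%:R / m%:R) *: v =
      (i%:R / m%:R) *: (x + v) + (1 - i%:R / m%:R) *: x.
    by rewrite scalerDr scalerBl scale1r [RHS]addrC addrA subrK.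
  apply: cK => //; rewrite divr_ge0//= ler_pdivrMr ?ltr0n// mul1r ler_nat.
  by rewrite -ltnS.
apply: equidistant_separated l0 small ij => a b Ka Kb.
by rewrite (le_trans (ler_normB _ _))// lerD ?KM.
Qed.

End ConvexBodies.

(** * The covering index in terms of covering numbers *)

Section CoveringIndex.
Context {R : realType} {d : nat}.
Notation V := 'rV[R]_d.
Implicit Types (L : {vspace V}) (K : set V) (lambda mu : R) (m : nat) (t x y v : V).

(** In this form, where [s i] is the image of [x] in the [i]-th homothet, a
    covering persists in the limit with respect to [lambda] and [s]. If the
    homothet meets [K] in the image [y] of [a], then
    [s i = y + lambda *: (x - a)], whence the bound; if it misses [K], then [s i]
    is irrelevant and is reset to [0]. *)
Lemma coverable_bounded L K lambda m x (M : R) : lambda != 0 -> `|lambda| <= M ->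
  (forall y, K y -> `|y| <= M) -> K x ->
  coverable L lambda m K ->
  exists s : 'I_m -> V,
    (forall i, `|s i| <= M + M * (M + M)) /\
    (forall y, K y -> exists i, K (lambda^-1 *: (y - s i) + x)).
Proof.
move=> l0 lM KM Kx /coverableP[t tL cov].
have M0 : 0 <= M by exact: le_trans lM.
pose meets i := `[< exists2 y, K y & homothet lambda K (t i) y >].
exists (fun i => if meets i then t i + lambda *: x else 0); split=> [i|y Ky].
  case: ifPn => [/asboolP[y Ky [a Ka eqy]]|_]; last first.
    by rewrite normr0 !(addr_ge0, mulr_ge0).
  have -> : t i + lambda *: x = y + lambda *: (x - a).
    by rewrite -eqy scalerBr [RHS]addrC addrA subrK addrC.
  apply: le_trans (ler_normD _ _) _; rewrite lerD ?KM// normrZ ler_pM//.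
  by rewrite (le_trans (ler_normB _ _))// lerD ?KM.
have [i tiy] := cov y Ky; exists i.
have -> : meets i by apply/asboolP; exists y.
move/homothetE : tiy => /(_ l0); congr (K _).
by rewrite opprD addrA [in RHS]scalerBr scalerK// subrK.
Qed.

(** Take a cluster point [u] of the bounded vectors of [coverable_bounded] as the
    ratio decreases to [g := gamma L m K]. If [u] failed to cover some [y] with
    ratio [g], then, [K] being closed, so would all nearby vectors with all nearby
    ratios, and some of these come from a covering. *)
Lemma coverable_gamma L K m : convex_body L K -> L != 0%VS -> (0 < m)%N ->
  coverable L (gamma L m K) m K.
Proof.
move=> bK L0 m0; have g0 := gamma_gt0 bK L0 m0; set g := gamma L m K in g0 *.
have [KL _ compK [x Kx _]] := bK.
have xL : x \in L by exact: KL.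
have [M M0 KM] := compact_norm_le compK.
pose M' := M + (g + 1).
pose C := [set v : V | `|v| <= M' + M' * (M' + M')].
have g10 : 0 < g + 1 by rewrite addr_gt0.
have compC : compact C.
  apply: bounded_closed_compact.
    exists (M' + M' * (M' + M')); split=> [|e /ltW eM v /le_trans]; last exact.
    exact: num_real.
  have -> : C = closed_ball_ Num.norm (0 : V) (M' + M' * (M' + M')).
    by apply/seteqP; split=> v; rewrite /C /closed_ball_/= sub0r normrN.
  exact: closed_closed_ball_.
have closedK : closed K by apply: compact_closed compK; exact: norm_hausdorff.
have /choice[s sP] lambda : exists s : 'I_m -> V, g < lambda <= g + 1 ->
    (forall i, C (s i)) /\
    (forall y, K y -> exists i, K (lambda^-1 *: (y - s i) + x)).
  have [/andP[gl lg]|_] := boolP (g < lambda <= g + 1); last by exists (fun=> 0).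
  have l0 : 0 < lambda by exact: lt_trans gl.
  have lM' : `|lambda| <= M' by rewrite gtr0_norm// (le_trans lg)// lerDr ltW.
  have KM' y : K y -> `|y| <= M' by move=> /KM /le_trans; apply; rewrite lerDl ltW.
  have [|s ?] := coverable_bounded _ lM' KM' Kx (coverable_gamma_lt bK m0 gl).
    by rewrite gt_eqF.
  by exists s.
have near_s : \forall lambda \near g^'+, g < lambda <= g + 1.
  near=> lambda; apply/andP; split; near: lambda.
    exact: nbhs_right_gt.
  by apply: nbhs_right_le; rewrite ltrDl.
have [] := @tychonoff _ (fun _ : 'I_m => V : topologicalType) (fun=> C)
  (fun=> compC) (s @ g^'+).
  by apply: (@filterS _ g^'+ _ _ _ _ near_s) => lambda gl i; exact: (sP lambda gl).1.
move=> u [_ clu].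
suff cov y : K y -> exists i, K (g^-1 *: (y - u i) + x).
  (* [u i] is known to come from a vector of [L] only if its homothet meets [K]. *)
  pose used i := `[< exists2 y, K y & K (g^-1 *: (y - u i) + x) >].
  apply/coverableP; exists (fun i => if used i then u i - g *: x else 0) => [i|y Ky].
    case: ifPn => [/asboolP[y Ky Kyi]|_]; last exact: mem0v.
    have -> : u i - g *: x = y - g *: (g^-1 *: (y - u i) + x).
      by rewrite scalerDr scalerKV ?gt_eqF// opprD opprB addrA addrC [y + _]addrC subrK addrC.
    by rewrite memvB ?memvZ//; exact: KL.
  have [i Kyi] := cov y Ky; exists i; apply/homothetE; first by rewrite gt_eqF.
  have -> : used i by apply/asboolP; exists y.
  by rewrite opprB addrA [_ + _ - _]addrAC scalerDr scalerK// gt_eqF.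
move=> Ky; apply: contrapT => /forallNP notK.
have nK i : \forall p \near (g, u i), ~ K (p.1^-1 *: (y - p.2) + x).
  have cont : (p.1^-1 *: (y - p.2) + x) @[p --> (g, u i)] --> g^-1 *: (y - u i) + x.
    apply: cvgD; last exact: cvg_cst.
    apply: cvgZ; first by apply: cvgV; [rewrite gt_eqF|exact: cvg_fst].
    by apply: cvgB; [exact: cvg_cst|exact: cvg_snd].
  apply: (cont (~` K)); apply: open_nbhs_nbhs; split; last exact: notK.
  exact: closed_openC.
have /choice[AB ABP] i : exists AB : set R * set V, [/\ nbhs g AB.1, nbhs (u i) AB.2 &
    forall lambda v, AB.1 lambda -> AB.2 v -> ~ K (lambda^-1 *: (y - v) + x)].
  have [[A B] /= [nA nB] AB] := nK i; exists (A, B); split => // lambda v Al Bv.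
  exact: (AB (lambda, v)).
pose A := s @` [set lambda | g < lambda <= g + 1 /\ forall i, (AB i).1 lambda].
pose B := [set f : 'I_m -> V | forall i, (AB i).2 (f i)].
have near_A : \forall lambda \near g^'+, forall i, (AB i).1 lambda.
  have nA : \forall lambda \near g, forall i, (AB i).1 lambda.
    apply: (@filter_forall R _ (fun i => (AB i).1) (nbhs g)) => i.
    by have [] := ABP i.
  by apply: (@filterS _ (nbhs g) _ _ _ _ nA) => lambda Al _.
have [||_ [[lambda [gl Al] <-] Bs]] := clu A B.
- apply: (@filterS2 _ g^'+ _ _ _ _ _ near_s near_A) => lambda gl Al.
  by exists lambda.
- apply: (@filter_forall ('I_m -> V) _ (fun i f => (AB i).2 (f i)) (nbhs u)) => i.
  have [_ nB _] := ABP i.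
  exact: (@proj_continuous _ (fun _ : 'I_m => V : topologicalType) i u _ nB).
have [_ /(_ y Ky)[i Ki]] := sP lambda gl.
by have [_ _ /(_ _ _ (Al i) (Bs i))] := ABP i.
Unshelve. all: by end_near. Qed.

Lemma coverable_gammaP L K m lambda : convex_body L K -> L != 0%VS ->
  (0 < m)%N -> 0 < lambda ->
  coverable L lambda m K <-> gamma L m K <= lambda.
Proof.
move=> bK L0 m0 l0; split=> [|gl]; first exact: gamma_le.
have [KL cK _ [x Kx _]] := bK.
apply: coverable_le (coverable_gamma bK L0 m0) => //; first by exists x.
by rewrite gamma_gt0.
Qed.

(** From [m] to [lambda], use [lambda := gamma L m K], for which [m] homothets
    suffice by [coverable_gamma]; from [lambda] to [m], use the covering number,
    whose [gamma] is at most [lambda]. *)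
Lemma coin_covering_number L K : convex_body L K -> L != 0%VS ->
  coin L K = ereal_inf [set ((covering_number L lambda K)%:R / (1 - lambda))%:E
                       | lambda in [set lambda : R | 0 < lambda <= 2^-1]].
Proof.
move=> bK L0; apply/eqP; rewrite eq_le; apply/andP; split.
  apply/ereal_infP => _ [lambda /andP[l0 l2] <-].
  have N0 := covering_number_gt0 bK l0.
  apply: ge_ereal_inf; exists (f_ L (covering_number L lambda K) K).
    by exists (covering_number L lambda K).
  have gl : gamma L (covering_number L lambda K) K <= lambda.
    by apply/coverable_gammaP => //; apply/covering_numberP.
  rewrite /f_ gamma_gt0//= (le_trans gl l2) lee_fin.
  by rewrite ler_pM2l ?ltr0n// lef_pV2 ?posrE; lra.
apply/ereal_infP => _ [m /= m0 <-]; rewrite /f_.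
case: ifPn => [/andP[g0 g2]|_]; last by rewrite leey.
apply: ge_ereal_inf; eexists; first by exists (gamma L m K) => //=; rewrite g0.
rewrite lee_fin ler_pM2r ?invr_gt0 ?subr_gt0; last by lra.
by rewrite ler_nat; apply/covering_numberP => //; exact: coverable_gamma.
Qed.

End CoveringIndex.

(** * Direct sums of convex bodies *)

Section DirectSums.
Context {R : realType} {d : nat}.
Notation V := 'rV[R]_d.
Implicit Types (lambda : R).

Lemma sum_continuous (T : topologicalType) (I : finType) (f : I -> T -> V) :
  (forall i, continuous (f i)) -> continuous (fun x => \sum_i f i x).
Proof.
move=> cf.
have add_cont : continuous (fun z : V * V => z.1 + z.2) by exact: add_continuous.
by apply: (@continuous_big V I +%R 0 xpredT add_cont T (index_enum I) f) => i _; exact: cf.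
Qed.

Lemma linear_continuous_rV (f : {linear V -> V}) : continuous f.
Proof.
have -> : (f : V -> V) = (fun v : V => \sum_j v 0 j *: f (delta_mx 0 j)).
  apply/funext => v; rewrite [in LHS](row_sum_delta v) linear_sum.
  by apply: eq_bigr => j _; rewrite linearZ.
apply: (sum_continuous (T := V) (f := fun j (v : V) => v 0 j *: f (delta_mx 0 j))) => j v.
by apply: (@cvgZr_tmp R V V (nbhs v)); exact: coord_continuous.
Qed.

Variables (n : nat) (L : 'I_n -> {vspace V}) (K : 'I_n -> set V).
Hypothesis dxL : directv (\sum_(i < n) L i)%VS.

Lemma direct_sum_component (u v : 'I_n -> V) :
  (forall i, u i \in L i) -> (forall i, v i \in L i) ->
  \sum_i u i = \sum_i v i -> forall i, u i = v i.
Proof.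
move=> uL vL /eqP; rewrite (directv_sum_unique dxL)//= => /forallP uv i.
by have /eqP := uv i.
Qed.

Hypothesis KL : forall i, K i `<=` [set` L i].

Lemma direct_sumP (k : 'I_n -> V) : (forall i, k i \in L i) ->
  direct_sum K (\sum_i k i) <-> forall i, K i (k i).
Proof.
move=> kL; split=> [[x xK eqx] i|kK]; last by exists k.
by rewrite -(direct_sum_component _ kL eqx)// => j; exact: KL.
Qed.

Lemma homothet_direct_sum lambda (k t : 'I_n -> V) : lambda != 0 ->
  (forall i, k i \in L i) -> (forall i, t i \in L i) ->
  homothet lambda (direct_sum K) (\sum_i t i) (\sum_i k i) <->
  forall i, homothet lambda (K i) (t i) (k i).
Proof.
move=> l0 kL tL; rewrite homothetE// -sumrB scaler_sumr direct_sumP.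
  by split=> kt i; apply/homothetE.
by move=> i; rewrite memvZ ?memvB.
Qed.

Hypothesis LV : (\sum_(i < n) L i)%VS = fullv.

Lemma memv_direct_sum v :
  exists2 u : 'I_n -> V, (forall i, u i \in L i) & v = \sum_i u i.
Proof.
have : v \in (\sum_(i < n) L i)%VS by rewrite LV memvf.
by case/memv_sumP => u uL ->; exists u => // i; exact: uL.
Qed.

(** The sum is a continuous image of the product of the summands. A sum of
    interior points is interior because the projections onto the [L i] are
    continuous. *)
Lemma convex_body_direct_sum : (forall i, convex_body (L i) (K i)) ->
  convex_body fullv (direct_sum K).
Proof.
move=> bK; split; first by move=> v _; exact: memvf.
- apply/convex_setP => _ _ a a01 [x xK <-] [y yK <-].
  exists (fun i => a *: x i + (1 - a) *: y i) => [i|].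
    by have [_ /convex_setP cK _ _] := bK i; exact: cK.
  by rewrite big_split/= -!scaler_sumr.
- pose f (k : prod_topology (fun _ : 'I_n => V : topologicalType)) := \sum_i k i : V.
  apply: (@continuous_compact _ _ f).
    apply/continuous_subspaceT.
    apply: (sum_continuous (T := prod_topology (fun _ : 'I_n => V : topologicalType))
      (f := fun i k => k i)) => i.
    exact: proj_continuous.
  by apply: (tychonoff (A := K)) => i; have [] := bK i.
- have /choice[x xP] i : exists x, K i x /\ \forall y \near x, y \in L i -> K i y.
    by have [_ _ _ [x]] := bK i; exists x.
  exists (\sum_i x i); first by exists x => // i; exact: (xP i).1.
  have xL i : x i \in L i by apply: KL; exact: (xP i).1.
  pose pr i : V -> V := sumv_pi (\sum_(i < n) L i)%VS i.
  have prL i y : pr i y \in L i by exact: memv_sum_pi.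
  have sum_pr y : \sum_i pr i y = y by apply: sumv_pi_sum; rewrite LV memvf.
  have pr_x i : pr i (\sum_i x i) = x i.
    by apply: (direct_sum_component (u := pr^~ (\sum_i x i))).
  have near_pr : \forall y \near \sum_i x i, forall i, K i (pr i y).
    apply: (@filter_forall V _ (fun i y => K i (pr i y)) (nbhs (\sum_i x i))) => i.
    have := (xP i).2; rewrite -{1}pr_x => /linear_continuous_rV.
    by apply: (@filterS _ (nbhs (\sum_i x i))) => y; apply; exact: prL.
  apply: (@filterS _ (nbhs (\sum_i x i)) _ _ _ _ near_pr) => y Ky _.
  by exists (pr^~ y).
Qed.

End DirectSums.

(** * Covering numbers of direct sums *)

(** The pairs of an index [a] and an element of [J a], counted in both orders. *)
Lemma leq_disjoint_family (A I : finType) (J : A -> {set I}) (k : nat) :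
  (forall a, k <= #|J a|)%N -> (forall a b i, i \in J a -> i \in J b -> a = b) ->
  (#|A| * k <= #|I|)%N.
Proof.
move=> kJ disj; rewrite -sum_nat_const -[leqRHS]sum1_card.
apply: (@leq_trans (\sum_a #|J a|)%N); first exact: leq_sum.
under eq_bigr do rewrite -sum1_card.
rewrite (exchange_big_dep xpredT)//=; apply: leq_sum => i _.
by rewrite sum1dep_card; apply/card_le1_eqP => a b; rewrite !inE => ia ib; exact: disj ib ia.
Qed.

Lemma card_dffun_ord (I : finType) (N : I -> nat) :
  #|{dffun forall i, 'I_(N i)}| = (\prod_i N i)%N.
Proof.
by rewrite card_dep_ffun foldrE big_map big_enum; apply: eq_bigr => i _; exact: card_ord.
Qed.

Section DirectSumCovering.
Context {R : realType} {d : nat}.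
Notation V := 'rV[R]_d.
Implicit Types (lambda : R).
Variables (n : nat) (L : 'I_n -> {vspace V}) (K : 'I_n -> set V).
Hypotheses (dxL : directv (\sum_(i < n) L i)%VS) (LV : (\sum_(i < n) L i)%VS = fullv).
Hypothesis bK : forall i, convex_body (L i) (K i).

Let KL i : K i `<=` [set` L i].
Proof. by have [] := bK i. Qed.

(** One homothet of the sum for each way of choosing one homothet per summand. *)
Lemma coverable_direct_sum lambda (N : 'I_n -> nat) : lambda != 0 ->
  (forall i, coverable (L i) lambda (N i) (K i)) ->
  coverable fullv lambda (\prod_i N i) (direct_sum K).
Proof.
move=> l0 covK; rewrite -card_dffun_ord.
have t i : {t : 'I_(N i) -> V | (forall a, t a \in L i) /\
    forall y, K i y -> exists a, homothet lambda (K i) (t a) y}.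
  by apply: cid; case/coverableP: (covK i) => t tL cov; exists t.
pose s (a : {dffun forall i, 'I_(N i)}) := \sum_i sval (t i) (a i).
apply: (coverable_card (t := s)) => [a|_ [k kK <-]]; first exact: memvf.
have a i : {a | homothet lambda (K i) (sval (t i) a) (k i)}.
  by apply: cid; exact: (svalP (t i)).2.
exists [ffun i => sval (a i)].
apply/(homothet_direct_sum dxL KL l0) => [i|i|i]; rewrite ?ffunE.
- exact: KL.
- exact: (svalP (t i)).1.
- exact: svalP (a i).
Qed.

(** Choose in each summand other than [K i0] the points witnessing that it is
    tightly covered. Each tuple [a] of such points determines a fibre of the sum,
    a translate of [K i0]. The homothets of a covering whose components contain
    the points of [a] form the set [J a]; their components in [L i0] cover [K i0],
    and the sets [J a] are disjoint. *)
Lemma direct_sum_covering_ge lambda m (i0 : 'I_n) : 0 < lambda < 1 ->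
  (forall i, i != i0 -> tightly_covered (L i) (K i)) ->
  coverable fullv lambda m (direct_sum K) ->
  (\prod_i covering_number (L i) lambda (K i) <= m)%N.
Proof.
move=> l01 tight /coverableP[t _ cov]; have /andP[l0 l1] := l01.
have ln0 : lambda != 0 by rewrite gt_eqF.
(* The value [1] at [i0] makes the dependent functions of the lemma
   [card_dffun_ord] index the fibres. *)
pose N i := if i == i0 then 1%N else covering_number (L i) lambda (K i).
have p i : {p : 'I_(N i) -> V | (forall a, K i (p a)) /\
    forall a b s, s \in L i -> homothet lambda (K i) s (p a) ->
      homothet lambda (K i) s (p b) -> a = b}.
  apply: cid; rewrite /N; case: eqVneq => [_|ii0].
    have [_ _ _ [x Kx _]] := bK i.
    by exists (fun=> x); split=> // a b; rewrite !ord1.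
  have [p [_ Kp sep]] := tight i ii0 lambda l01; exists p; split=> // a b s sL sa sb.
  by apply/eqP/contraT => /sep; case; exists s.
have /choice[tau tauP] j : exists u : 'I_n -> V,
    (forall i, u i \in L i) /\ t j = \sum_i u i.
  by have [u ? ?] := memv_direct_sum LV (t j); exists u.
pose J (a : {dffun forall i, 'I_(N i)})  : {set 'I_m} := finset (fun j =>
  [forall i, (i != i0) ==> `[< homothet lambda (K i) (tau j i) (sval (p i) (a i)) >]]).
have JP a j i : j \in J a -> i != i0 ->
    homothet lambda (K i) (tau j i) (sval (p i) (a i)).
  by rewrite inE => /forallP/(_ i)/implyP h /h/asboolP.
have -> : (\prod_i covering_number (L i) lambda (K i) =
    #|{dffun forall i, 'I_(N i)}| * covering_number (L i0) lambda (K i0))%N.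
  rewrite card_dffun_ord (bigD1 i0)//= [X in _ = (X * _)%N](bigD1 i0)//=.
  rewrite /N eqxx mul1n mulnC; congr (_ * _)%N.
  by apply: eq_bigr => i /negbTE ->.
rewrite -[leqRHS]card_ord. apply: (@leq_disjoint_family _ _ J) => [a|a b j ja jb].
  apply/covering_numberP => //; rewrite -card_sig.
  apply: (coverable_card (t := fun j : {j | j \in J a} => tau (val j) i0)) => [j|y Ky].
    exact: (tauP _).1.
  pose k i := if i == i0 then y else sval (p i) (a i).
  have kK i : K i (k i).
    by rewrite /k; case: eqP => [->//|_]; exact: (svalP (p i)).1.
  have [j] : exists j, homothet lambda (direct_sum K) (t j) (\sum_i k i).
    by apply: cov; exists k.
  rewrite (tauP j).2 => /(homothet_direct_sum dxL KL ln0) kt.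
  have {}kt i : homothet lambda (K i) (tau j i) (k i).
    by apply: kt => {}i; [exact: KL|exact: (tauP j).1].
  have ja : j \in J a.
    rewrite inE; apply/forallP => i; apply/implyP => /negbTE ii0; apply/asboolP.
    by have := kt i; rewrite /k ii0.
  by exists (exist _ j ja); have := kt i0; rewrite /k eqxx.
apply/ffunP => i; have [ii0|ii0] := eqVneq i i0.
  have Ni : N i = 1%N by rewrite /N ii0 eqxx.
  by apply/val_inj; move: (a i) (b i); rewrite Ni => ? ?; rewrite !ord1.
exact: (svalP (p i)).2 ((tauP j).1 i) (JP a j i ja ii0) (JP b j i jb ii0).
Qed.

Lemma covering_number_direct_sum lambda (i0 : 'I_n) : 0 < lambda < 1 ->
  (forall i, i != i0 -> tightly_covered (L i) (K i)) ->
  covering_number fullv lambda (direct_sum K) =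
    (\prod_i covering_number (L i) lambda (K i))%N.
Proof.
move=> l01 tight; have /andP[l0 _] := l01.
have bS := convex_body_direct_sum dxL KL LV bK.
apply/eqP; rewrite eqn_leq; apply/andP; split.
  apply/covering_numberP => //; apply: coverable_direct_sum => [|i].
    by rewrite gt_eqF.
  exact/covering_numberP.
by apply: direct_sum_covering_ge tight _ => //; apply/covering_numberP.
Qed.

End DirectSumCovering.

(** * Bounds on the covering index of a direct sum *)

Section CoinDirectSum.
Context {R : realType} {d : nat}.
Notation V := 'rV[R]_d.
Implicit Types (lambda : R).

Lemma coin_lt_pinfty (L : {vspace V}) (K : set V) :
  convex_body L K -> L != 0%VS -> (coin L K < +oo)%E.
Proof.
move=> bK L0; rewrite coin_covering_number//.
apply: (@le_lt_trans _ _ ((covering_number L (2^-1 : R) K)%:R / (1 - 2^-1))%:E);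
  last exact: ltry.
by apply: ge_ereal_inf; eexists; first by exists (2^-1 : R) => //=; rewrite invr_gt0 ltr0n lexx.
Qed.

Lemma coin_attained (L : {vspace V}) (K : set V) m :
  convex_body L K -> L != 0%VS -> coin L K = f_ L m K ->
  0 < gamma L m K <= 2^-1 /\ coin L K = (m%:R / (1 - gamma L m K))%:E.
Proof.
move=> bK L0; rewrite /f_; case: ifP => // _ eq_oo.
by have := coin_lt_pinfty bK L0; rewrite eq_oo ltxx.
Qed.

Lemma card_pred_exception (n : nat) (A : {set 'I_n}) : (0 < n)%N -> #|A| = n.-1 ->
  exists i0, forall i, i != i0 -> i \in A.
Proof.
move=> n0 cA; have /eqP/cards1P[i0 Ai0] : #|~: A|%SET = 1%N.
  by rewrite cardsCs finset.setCK card_ord cA; case: n n0 {A cA} => // n _; rewrite subSnn.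
exists i0 => i; apply: contraNT => iA.
by rewrite -finset.in_set1 -Ai0 finset.in_setC.
Qed.

Variables (n : nat) (L : 'I_n -> {vspace V}) (K : 'I_n -> set V) (m : 'I_n -> nat).
Hypothesis hyp : coin_sum_hyp L K m.

Lemma coin_direct_sum : coin fullv (direct_sum K) =
  ereal_inf [set (covering_ratio L K lambda)%:E
            | lambda in [set lambda : R | 0 < lambda <= 2^-1]].
Proof.
have [n2 [dxL LV L0] bK _ [A cA tight]] := hyp.
have n0 : (0 < n)%N by exact: ltnW.
have KL i : K i `<=` [set` L i] by have [] := bK i.
have [i0 i0P] := card_pred_exception n0 cA.
have V0 : fullv != 0%VS :> {vspace V}.
  by apply: contraNneq (L0 i0) => V0; rewrite -subv0 -V0 subvf.
rewrite (coin_covering_number (convex_body_direct_sum dxL KL LV bK) V0).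
congr ereal_inf; apply: eq_imagel => lambda /andP[l0 l2].
rewrite (covering_number_direct_sum dxL LV bK (i0 := i0))//; last first.
  by move=> i /i0P; exact: tight.
by rewrite l0 (le_lt_trans l2)// invf_lt1 ?ltr1n.
Qed.

Lemma le_coin_direct_sum i : (coin (L i) (K i) <= coin fullv (direct_sum K))%E.
Proof.
have [_ [_ _ L0] bK _ _] := hyp.
rewrite coin_direct_sum coin_covering_number//.
apply/ereal_infP => _ [lambda /= /andP[l0 l2] <-].
apply: ge_ereal_inf; eexists; first by exists lambda => //=; rewrite l0.
rewrite lee_fin ler_pM2r ?ler_nat.
  rewrite (bigD1 i)//= leq_pmulr// prodn_gt0// => j; exact: covering_number_gt0.
by rewrite invr_gt0 subr_gt0 (le_lt_trans l2)// invf_lt1 ?ltr1n.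
Qed.

Let gammaP i : 0 < gamma (L i) (m i) (K i) <= 2^-1 /\
  coin (L i) (K i) = ((m i)%:R / (1 - gamma (L i) (m i) (K i)))%:E.
Proof. by have [_ [_ _ L0] bK coinK _] := hyp; apply: coin_attained => //; case: (coinK i). Qed.

Lemma Gamma_attained : exists i, Gamma L K m = gamma (L i) (m i) (K i).
Proof.
have [n2 _ _ _ _] := hyp; have i : 'I_n by exact: Ordinal n2.
rewrite /Gamma (bigmax_eq_arg _ i)//; first by eexists.
by move=> j _; have [/andP[/ltW]] := gammaP j.
Qed.

Lemma Gamma_itv : 0 < Gamma L K m <= 2^-1.
Proof. by have [i ->] := Gamma_attained; have [] := gammaP i. Qed.

Lemma covering_ratio_Gamma_le :
  covering_ratio L K (Gamma L K m) <= (\prod_(i < n) m i)%N%:R / (1 - Gamma L K m).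
Proof.
have [_ [_ _ L0] bK coinK _] := hyp; have /andP[G0 G2] := Gamma_itv.
rewrite ler_pM2r ?invr_gt0; last by lra.
rewrite ler_nat; apply: leq_prod => i _; apply/covering_numberP => //.
by apply/coverable_gammaP => //; [case: (coinK i)|exact: le_bigmax].
Qed.

(** The product of the denominators has the factor [1 - Gamma L K m] and at least
    one more factor, all factors being less than [1]. *)
Lemma lt_prod_coin :
  (((\prod_(i < n) m i)%N%:R / (1 - Gamma L K m))%R%:E < \prod_(i < n) coin (L i) (K i))%E.
Proof.
have [n2 _ _ coinK _] := hyp.
rewrite (eq_bigr _ (fun i _ => (gammaP i).2)) prodEFin lte_fin.
rewrite big_split/= -natr_prod prodfV.
have g i : 0 < 1 - gamma (L i) (m i) (K i) < 1.
  by have [/andP[? ?] _] := gammaP i; apply/andP; split; lra.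
rewrite ltr_pM2l; last by rewrite ltr0n prodn_gt0// => i; case: (coinK i).
have [i ->] := Gamma_attained.
rewrite (bigD1 i)//= ltf_pV2 ?posrE; last 2 first.
- by case/andP: (g i).
- by rewrite mulr_gt0// ?prodr_gt0// => [|j _]; [case/andP: (g i)|case/andP: (g j)].
rewrite gtr_pMr; last by case/andP: (g i).
have prod1 : \prod_(j < n | j != i) 1 = 1 :> R by rewrite big1.
rewrite -[ltRHS]prod1.
apply: ltr_prod => [|j _]; last by case/andP: (g j) => /ltW -> ->.
have /card_gt0P[j ji] : (0 < #|predC1 i|)%N by rewrite cardC1 card_ord -ltnS prednK// ltnW.
by apply/hasP; exists j; rewrite ?mem_index_enum.
Qed.

End CoinDirectSum.

(** * Segments and the unit square *)

Section Segments.
Context {R : realType} {d : nat}.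
Notation V := 'rV[R]_d.
Implicit Types (lambda : R) (v : V).

Definition segment v : set V := [set s *: v | s in `[0, 1]%classic].

Variable v : V.
Hypothesis v0 : v != 0.

Lemma segmentZ s : 0 <= s <= 1 -> segment v (s *: v).
Proof. by move=> s01; exists s => //=; rewrite in_itv. Qed.

Lemma convex_body_segment : convex_body <[v]>%VS (segment v).
Proof.
split.
- by move=> _ [s _ <-] /=; rewrite memvZ// memv_line.
- apply/convex_setP => _ _ a /andP[a0 a1] [s /= + <-] [t /= + <-].
  rewrite !in_itv/= => /andP[s0 s1] /andP[t0 t1].
  rewrite !scalerA -scalerDl; apply: segmentZ; apply/andP; split; nra.
- apply: (@continuous_compact R V (fun s : R => s *: v)); last exact: segment_compact.
  by apply: continuous_subspaceT => s; apply: cvgZr_tmp; exact: cvg_id.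
- have nv : 0 < `|v| by rewrite normr_gt0.
  exists (2^-1 *: v); first by apply: segmentZ; apply/andP; split; lra.
  apply/nbhs_ballP; exists (2^-1 * `|v|); first by rewrite /= mulr_gt0.
  move=> y + /vlineP[c eqy]; rewrite -ball_normE/= eqy -scalerBl normrZ ltr_pM2r//.
  by rewrite ltr_norml => /andP[? ?]; apply: segmentZ; apply/andP; split; lra.
Qed.

Lemma segment_diameter a b : segment v a -> segment v b -> `|a - b| <= `|v|.
Proof.
move=> [s /= + <-] [t /= + <-]; rewrite !in_itv/= => /andP[s0 s1] /andP[t0 t1].
by rewrite -scalerBl normrZ ler_piMl// ler_norml; apply/andP; split; lra.
Qed.

Lemma segment_equidistant m (i : 'I_m.+1) : segment v (0 + (i%:R / m%:R) *: v).
Proof.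
rewrite add0r; apply: segmentZ; rewrite divr_ge0//=.
case: m i => [|m] i; first by rewrite invr0 mulr0.
by rewrite ler_pdivrMr ?ltr0n// mul1r ler_nat -ltnS.
Qed.

Lemma segment_separated lambda m t (i j : 'I_m.+1) : 0 < lambda -> m%:R * lambda < 1 ->
  i != j ->
  homothet lambda (segment v) t (0 + (i%:R / m%:R) *: v) ->
  homothet lambda (segment v) t (0 + (j%:R / m%:R) *: v) -> False.
Proof.
move=> l0 ml; apply: equidistant_separated segment_diameter l0 _.
by rewrite mulrC [lambda * _]mulrC gtr_pMr ?normr_gt0.
Qed.

Lemma exists_interval lambda m s : 0 <= s -> s <= m.+1%:R * lambda ->
  exists i : 'I_m.+1, i%:R * lambda <= s <= i.+1%:R * lambda.
Proof.
move=> s0; elim: m => [|m IHm] sm; first by exists ord0; rewrite mul0r s0.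
have [/IHm[i]|ms] := leP s (m.+1%:R * lambda).
  by exists (widen_ord (leqnSn _) i).
by exists ord_max; rewrite /= (ltW ms).
Qed.

Lemma coverable_segment lambda m : 0 < lambda ->
  coverable <[v]>%VS lambda m (segment v) <-> 1 <= m%:R * lambda.
Proof.
move=> l0; split=> [cov|].
  rewrite leNgt; apply/negP => ml; apply: separated_not_coverable cov.
    exact: segment_equidistant.
  by move=> i j t ij _; exact: segment_separated.
case: m => [|m ml]; first by rewrite mul0r ler10.
apply/coverableP; exists (fun i : 'I_m.+1 => (i%:R * lambda) *: v) => [i|].
  by rewrite memvZ// memv_line.
move=> _ [s /= + <-]; rewrite in_itv/= => /andP[s0 s1].
have [i /andP[il ir]] := exists_interval s0 (le_trans s1 ml).
exists i; apply/homothetE; first by rewrite gt_eqF.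
rewrite -scalerBl scalerA; apply: segmentZ.
rewrite mulr_ge0 ?invr_ge0 ?subr_ge0 ?(ltW l0)//=.
by rewrite ler_pdivrMl// mulr1 lerBlDl; move: ir; rewrite -natr1 mulrDl mul1r.
Qed.

Lemma covering_number_segment lambda m : 0 < lambda ->
  (covering_number <[v]>%VS lambda (segment v) <= m)%N <-> 1 <= m%:R * lambda.
Proof.
move=> l0; rewrite -coverable_segment//.
by split => /covering_numberP; apply => //; exact: convex_body_segment.
Qed.

Lemma covering_number_segment_ge lambda : 0 < lambda ->
  1 <= (covering_number <[v]>%VS lambda (segment v))%:R * lambda.
Proof. by move=> l0; apply/covering_number_segment. Qed.

(** If the covering number is [k + 1], then [k] homothets do not suffice, that is,
    [lambda < 1 / k]. Hence [k + 1] equidistant points of the segment are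
    separated. *)
Lemma segment_tightly_covered : tightly_covered <[v]>%VS (segment v).
Proof.
move=> lambda /andP[l0 l1].
have := covering_number_segment (covering_number <[v]>%VS lambda (segment v)).-1 l0.
have := covering_number_gt0 convex_body_segment l0.
case: (covering_number _ _ _) => // k _; rewrite ltnn => kl.
have {}kl : k%:R * lambda < 1 by rewrite ltNge; apply/negP => /kl.
exists (fun i => 0 + (i%:R / k%:R) *: v); split=> [i j eqp|i|i j ij].
- apply/eqP/contraT => ij.
  case: (@segment_separated lambda k (0 + (i%:R / k%:R) *: v) i j) => //; rewrite -?eqp;
    by apply/homothetE; rewrite ?gt_eqF// subrr scaler0 -(scale0r v);
       apply: segmentZ; rewrite lexx ler01.
- exact: segment_equidistant.
- by case=> t _ [ti tj]; exact: segment_separated ti tj.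
Qed.

Lemma gamma2_segment : gamma <[v]>%VS 2 (segment v) = 2^-1.
Proof.
have bS := convex_body_segment.
have L0 : <[v]>%VS != 0%VS by rewrite -dimv_eq0 dim_vline v0.
apply/eqP; rewrite eq_le; apply/andP; split.
  by apply: gamma_le; rewrite ?invr_gt0//; apply/coverable_segment => //; rewrite mulfV.
have /coverable_segment := coverable_gamma bS L0 (isT : (0 < 2)%N).
by move=> /(_ (gamma_gt0 bS L0 (isT : (0 < 2)%N))); lra.
Qed.

(** With [N >= 1 / lambda], the ratio [N / (1 - lambda)] is at least
    [N ^ 2 / (N - 1)], whose minimum [4] is taken at [N = 2]. *)
Lemma coin_segment : coin <[v]>%VS (segment v) = f_ <[v]>%VS 2 (segment v).
Proof.
have L0 : <[v]>%VS != 0%VS by rewrite -dimv_eq0 dim_vline v0.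
apply/eqP; rewrite eq_le; apply/andP; split.
  by apply: ge_ereal_inf; exists (f_ <[v]>%VS 2 (segment v)) => //; exists 2%N.
rewrite coin_covering_number//; last exact: convex_body_segment.
apply/ereal_infP => _ [lambda /= /andP[l0 l2] <-].
rewrite /f_ gamma2_segment invr_gt0 ltr0n lexx/= lee_fin.
have := covering_number_segment_ge l0.
move: (covering_number _ _ _)%:R => N Nl.
have Nge0 : 0 < N by rewrite -(pmulr_lgt0 _ l0) (lt_le_trans ltr01).
rewrite ler_pdivlMr; last by lra.
have -> : 1 - 2^-1 = 2^-1 :> R by lra.
rewrite invrK.
(* [(N - 2) ^+ 2 >= 0] and [N * lambda >= 1] give [N ^+ 2 >= 4 * N * (1 - lambda)]. *)
rewrite -(ler_pM2l Nge0); have : 0 <= (N - 2) * (N - 2) by rewrite -expr2 sqr_ge0.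
nra.
Qed.

End Segments.

Section UnitSquare.
Context {R : realType}.

Let e (i : 'I_2) : 'rV[R]_2 := delta_mx 0 i.
Let L i := <[e i]>%VS.
Let K i := segment (e i).
Let m (_ : 'I_2) := 2%N.

Lemma coordinate_lines_direct (n : nat) :
  directv (\sum_(i < n) <[(delta_mx 0 i : 'rV[R]_n)%R]>)%VS.
Proof.
apply/directv_sum_independent => u uL.
have /fin_all_exists[c cP] i : exists c, u i = c *: delta_mx 0 i.
  by have /vlineP[c ->] := uL i isT; exists c.
move=> sum0 i _; rewrite cP; suff -> : c i = 0 by rewrite scale0r.
have := congr1 (fun w : 'rV_n => w 0 i) sum0.
rewrite summxE mxE (bigD1 i)//= cP !mxE !eqxx mulr1.
rewrite big1 ?addr0// => j ji; by rewrite cP !mxE eqxx eq_sym (negbTE ji) mulr0.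
Qed.

Lemma coordinate_lines_full (n : nat) :
  (\sum_(i < n) <[(delta_mx 0 i : 'rV[R]_n)%R]>)%VS = fullv.
Proof.
apply/eqP; rewrite eqEsubv subvf; apply/subvP => w _.
by rewrite (row_sum_delta w) memv_sumr// => i _; rewrite memvZ// memv_line.
Qed.

Let e0 i : e i != 0.
Proof. by apply/eqP => /rowP/(_ i)/eqP; rewrite !mxE !eqxx oner_eq0. Qed.

Lemma unit_square_hyp : coin_sum_hyp L K m.
Proof.
split=> //.
- split; [exact: coordinate_lines_direct|exact: coordinate_lines_full|].
  by move=> i; rewrite -dimv_eq0 dim_vline e0.
- by move=> i; exact: convex_body_segment.
- by move=> i; split=> //; exact: coin_segment.
- by exists [set ord0]%SET; [rewrite cards1|move=> i _; exact: segment_tightly_covered].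
Qed.

(** The index is at least [8] by the estimate on a segment, and the last bound of
    the chain is [8]. *)
Lemma unit_square_sharp :
  coin fullv (direct_sum K) = (covering_ratio L K (Gamma L K m))%:E /\
  covering_ratio L K (Gamma L K m) = (\prod_(i < 2) m i)%N%:R / (1 - Gamma L K m).
Proof.
have le2 := covering_ratio_Gamma_le unit_square_hyp.
have G2 : Gamma L K m = 2^-1.
  by have [i ->] := Gamma_attained unit_square_hyp; exact: gamma2_segment.
have eq8 : (\prod_(i < 2) m i)%N%:R / (1 - Gamma L K m) = 8.
  rewrite G2 big_ord_recl big_ord1; have -> : 1 - 2^-1 = 2^-1 :> R by lra.
  by rewrite invrK -natrM.
have ge8 lambda : 0 < lambda <= 2^-1 -> 8 <= covering_ratio L K lambda.
  move=> /andP[l0 l2]; rewrite /covering_ratio big_ord_recl big_ord1 natrM.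
  have := covering_number_segment_ge (e0 ord0) l0.
  have := covering_number_segment_ge (e0 (lift ord0 ord0)) l0.
  rewrite -/(L _) -/(K _) -/(L _) -/(K _).
  set a := (covering_number _ _ (K (lift _ _)))%:R; set b := (covering_number _ _ _)%:R.
  move=> al bl; rewrite ler_pdivlMr; last by lra.
  have ab : 1 <= b * a * lambda ^+ 2 by rewrite expr2 mulrACA mulr_ege1.
  rewrite -(ler_pM2r (exprn_gt0 2 l0)) (le_trans _ ab)//.
  (* [2^-1] is a root of [1 - 8 * (1 - lambda) * lambda ^+ 2]. *)
  have h : 0 <= (1 - 2 * lambda) * (1 + 2 * lambda - 4 * lambda ^+ 2).
    by apply: mulr_ge0; nra.
  rewrite -subr_ge0; apply: le_trans h _.
  by rewrite le_eqVlt; apply/orP; left; apply/eqP; ring.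
have eqG : covering_ratio L K (Gamma L K m) = 8.
  by apply/eqP; rewrite eq_le -{1}eq8 le2 ge8//; exact: Gamma_itv unit_square_hyp.
split; last by rewrite eqG eq8.
rewrite (coin_direct_sum unit_square_hyp); apply/eqP; rewrite eq_le; apply/andP; split.
  apply: ge_ereal_inf; eexists; last exact: lexx.
  by exists (Gamma L K m); first exact: Gamma_itv unit_square_hyp.
by apply/ereal_infP => _ [lambda l <-]; rewrite eqG lee_fin ge8.
Qed.

End UnitSquare.

Theorem theorem4p1 (R : realType) :
  (forall (d n : nat) (L : 'I_n -> {vspace 'rV[R]_d})
          (K : 'I_n -> set 'rV[R]_d) (m : 'I_n -> nat),
     coin_sum_hyp L K m ->
     [/\ (\big[maxe/-oo]_(i < n) coin (L i) (K i)
            <= coin fullv (direct_sum K))%E,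
         coin fullv (direct_sum K) =
           ereal_inf [set (covering_ratio L K lambda)%:E
                     | lambda in [set lambda : R | 0 < lambda <= 2^-1]],
         (ereal_inf [set (covering_ratio L K lambda)%:E
                    | lambda in [set lambda : R | (0 < lambda <= 2^-1)%R]]
            <= (covering_ratio L K (Gamma L K m))%:E)%E,
         covering_ratio L K (Gamma L K m)
           <= (\prod_(i < n) m i)%N%:R / (1 - Gamma L K m) &
         (((\prod_(i < n) m i)%N%:R / (1 - Gamma L K m))%R%:E
            < \prod_(i < n) coin (L i) (K i))%E])
  /\ (exists (d n : nat) (L : 'I_n -> {vspace 'rV[R]_d})
          (K : 'I_n -> set 'rV[R]_d) (m : 'I_n -> nat),
        coin_sum_hyp L K m /\
        coin fullv (direct_sum K) = (covering_ratio L K (Gamma L K m))%:E)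
  /\ (exists (d n : nat) (L : 'I_n -> {vspace 'rV[R]_d})
          (K : 'I_n -> set 'rV[R]_d) (m : 'I_n -> nat),
        coin_sum_hyp L K m /\
        coin fullv (direct_sum K) =
          ((\prod_(i < n) m i)%N%:R / (1 - Gamma L K m))%:E).
Proof.
have [coin_ratio ratio_prod] := @unit_square_sharp R.
split; [move=> d n L K m hyp; split|split].
- by apply: bigmax_le => [|i _]; [exact: leNye|exact: le_coin_direct_sum hyp i].
- exact: coin_direct_sum hyp.
- apply: ge_ereal_inf; eexists; last exact: lexx.
  by exists (Gamma L K m) => //; exact: Gamma_itv.
- exact: covering_ratio_Gamma_le.
- exact: lt_prod_coin.
- by do 5!eexists; split; [exact: unit_square_hyp|].
- by do 5!eexists; split; [exact: unit_square_hyp|rewrite coin_ratio ratio_prod].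
Qed.
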